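(* Let $A$ and $B$ be two events with $A\neq\emptyset$ and $B\neq\emptyset$. Then $(A|B)\wedge(B|A)=(AB)|(A\vee B)$. That is, for every coherent assessment $(x,y,\mu,p)$ on $\{A|B,\ B|A,\ (A|B)\wedge(B|A),\ (AB)|(A\vee B)\}$ (with $x=P(A|B)$, $y=P(B|A)$, $\mu=\mathbb P[(A|B)\wedge(B|A)]$, $p=P[(AB)|(A\vee B)]$), the random quantities $(A|B)\wedge(B|A)$ and $(AB)|(A\vee B)$ take the same value on every constituent generated by $A,B$ (in particular, if $\overline A\,\overline B\ne\emptyset$, their values $\mu$ and $p$ on $\overline A\,\overline B$ coincide).
   Context: Events are elements of a Boolean algebra with sure event $\Omega$ and impossible event $\emptyset$; $\overline{E}$ is negation, $EF$ is conjunction, and an event is identified with its $0/1$ indicator. Constituents generated by $A,B$ are the nonimpossible ones among $AB,\ A\overline B,\ \overline AB,\ \overline A\,\overline B$. A conditional event $E|H$ ($H\ne\emptyset$) with $P(E|H)=p$ is, numerically, the quantity $EH+p\overline H$. With $P(A|B)=x$, $P(B|A)=y$, the conjunction is the conditional random quantity $(A|B)\wedge(B|A)=\min\{AB+x\overline B,\ AB+y\overline A\}\,|\,(A\vee B)$: it equals that minimum when $A\vee B$ is true and equals its prevision $\mu$ when $\overline A\,\overline B$ is true. Coherence: associate gains $G_1=B(A-x)$, $G_2=A(B-y)$, $G_3=(A|B)\wedge(B|A)-\mu$, $G_4=(A\vee B)(AB-p)$ and conditioning events $L_1=B$, $L_2=A$, $L_3=L_4=A\vee B$. The assessment $(x,y,\mu,p)$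 is coherent if for every nonempty $S\subseteq\{1,2,3,4\}$ and all reals $s_i$, the set $D$ of values of $\sum_{i\in S}s_iG_i$ on the constituents contained in $\bigvee_{i\in S}L_i$ satisfies $\min D\le0\le\max D$. (In the bet on $G_3$, as on any conditional random quantity, $G_3=0$ when $\overline A\,\overline B$ is true.) *)

(* Defs.v *)
From mathcomp Require Import all_boot all_order all_algebra.
From mathcomp Require Import reals.
Set Implicit Arguments.
Unset Strict Implicit.
Unset Printing Implicit Defensive.
Import Order.TTheory GRing.Theory Num.Theory.
Local Open Scope ring_scope.

(* Events are elements of a Boolean algebra T; a random quantity generated by
   A and B is a function T -> R, of which only the values at the constituents
   of A and B are meaningful. *)

Section Quantities.
Context {d : Order.disp_t} {T : ctbDistrLatticeType d} {R : realType}.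
Implicit Types (A B C E H L : T) (X : T -> R).

Definition constituents A B : seq T :=
  [seq C <- [:: A `&` B; A `&` ~` B; ~` A `&` B; ~` A `&` ~` B]%O
     | C != \bot%O].

(* If E is a Boolean combination of A and B, a constituent C of A and B lies
   below either E or ~` E, so this is the 0/1 truth value of E when C occurs. *)
Definition indic E : T -> R := fun C => ((C <= E)%O)%:R.

Definition cond_quantity X H (mu : R) : T -> R :=
  fun C => X C * indic H C + mu * indic (~` H)%O C.

Definition cond_event E H (p : R) : T -> R := cond_quantity (indic E) H p.

(* cond_event A B x is AB + x ~B, the value of A|B when P(A|B) = x. *)
Definition conjunction A B (x y mu : R) : T -> R :=
  cond_quantity
    (fun C => Num.min (cond_event A B x C) (cond_event B A y C))
    (A `|` B)%O mu.

Definition gains A B (x y mu p : R) : 4.-tuple (T -> R) :=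
  [tuple (fun C => indic B C * (indic A C - x));
         (fun C => indic A C * (indic B C - y));
         (fun C => conjunction A B x y mu C - mu);
         (fun C => indic (A `|` B)%O C * (indic (A `&` B)%O C - p))].

Definition conditioning A B : 4.-tuple T := [tuple B; A; A `|` B; A `|` B]%O.

(* Minimum and maximum of a nonempty list (0 on the empty one). *)
Definition seq_min (D : seq R) : R := \big[Num.min/head 0 D]_(v <- D) v.
Definition seq_max (D : seq R) : R := \big[Num.max/head 0 D]_(v <- D) v.

Definition bet_values n (cs : seq T) (G : n.-tuple (T -> R)) (L : n.-tuple T)
    (S : {set 'I_n}) (s : 'I_n -> R) : seq R :=
  [seq \sum_(i in S) s i * tnth G i C
     | C <- cs & (C <= \join_(i in S) tnth L i)%O].

(* The list of values is never empty below as soon as A and B are nonzero. *)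
Definition coherent A B (x y mu p : R) : Prop :=
  forall (S : {set 'I_4}) (s : 'I_4 -> R), S != set0 ->
    let D := bet_values (constituents A B) (gains A B x y mu p)
                        (conditioning A B) S s in
    seq_min D <= 0 <= seq_max D.

End Quantities.

(* Main.v *)
(** Betting on A|B alone forces x >= 0, and likewise y >= 0, so the minimum
    defining the conjunction is the indicator of AB on A \/ B.  Hence betting 1
    on the conjunction and -1 on (AB)|(A \/ B) yields the constant gain p - mu
    on A \/ B, and coherence forces mu = p. *)
Require Import Defs.
From mathcomp Require Import all_boot all_order all_algebra.
From mathcomp Require Import reals.
From mathcomp Require Import lra.
Import Order.TTheory Order.CTheory GRing.Theory Num.Theory.
Set Implicit Arguments.
Unset Strict Implicit.

Local Open Scope ring_scope.

Lemma le_seq_min (R : realType) (c : R) (D : seq R) :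
  D != [::] -> (forall v, v \in D -> c <= v) -> c <= seq_min D.
Proof.
case: D => // a D _ leD; rewrite /seq_min /=.
rewrite big_seq; apply: (big_ind (fun v => c <= v)) => //.
  (* The fold starts from the head of the list, so its default value is itself bounded below by
     [c]. *)
  by apply: leD; rewrite mem_head.
by move=> u v cu cv; rewrite le_min cu.
Qed.

Section Constituents.
Context {d : Order.disp_t} {T : ctbDistrLatticeType d}.
Implicit Types A B C E : T.

Lemma le_compl_nle C E : C != \bot%O ->
  (C <= E)%O || (C <= ~` E)%O -> (C <= ~` E)%O = ~~ (C <= E)%O.
Proof.
move=> C0; case: (boolP (C <= E)%O) => //= CE _; apply/negbTE.
apply: contra C0 => CE'.
by rewrite -lex0 -(meetxC E) lexI CE.
Qed.

Lemma constituent_le_compl A B C : C \in constituents A B ->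
  ((C <= ~` A)%O = ~~ (C <= A)%O) * ((C <= ~` B)%O = ~~ (C <= B)%O).
Proof.
rewrite mem_filter => /andP[C0 CAB].
by split; apply: le_compl_nle => //; move: CAB; rewrite !inE;
  case/or4P => /eqP ->; rewrite ?leIl ?leIr ?orbT.
Qed.

(** This fails for arbitrary [C]. A constituent decides both events, and one that is below neither
    is below their complements, hence below the complement of the join. *)
Lemma constituent_le_join A B C : C \in constituents A B ->
  (C <= A `|` B)%O = (C <= A)%O || (C <= B)%O.
Proof.
move=> CAB; have [CA CB] := constituent_le_compl CAB.
have C0 : C != \bot%O by move: CAB; rewrite mem_filter => /andP[].
have CU : (C <= ~` (A `|` B))%O = ~~ ((C <= A)%O || (C <= B)%O).
  by rewrite complU lexI CA CB negb_or.
have [CAoB|CAoB] := boolP ((C <= A)%O || (C <= B)%O).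
  by case/orP: CAoB => h; rewrite (le_trans h) ?leUl ?leUr.
apply/negbTE; rewrite -le_compl_nle ?CU //.
by rewrite CAoB orbT.
Qed.

Lemma has_constituent_le_l A B : A != \bot%O ->
  has (fun C => C <= A)%O (constituents A B).
Proof.
move=> A0; apply/hasP.
have [AB0|AB0] := eqVneq (A `&` B)%O \bot%O; last first.
  by exists (A `&` B)%O; rewrite ?leIl // mem_filter AB0 !inE eqxx.
exists (A `&` ~` B)%O; rewrite ?leIl // mem_filter !inE eqxx orbT andbT.
(* [A] is the join of its meets with [B] and with the complement of [B], so both cannot vanish. *)
apply: contra A0 => /eqP AB'0.
by rewrite -(meetx1 A) -(joinxC B) meetUr AB0 AB'0 joinxx.
Qed.

Lemma has_constituent_le_r A B : B != \bot%O ->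
  has (fun C => C <= B)%O (constituents A B).
Proof.
move=> B0; have := @has_constituent_le_l B A B0.
case/hasP => C CBA CB; apply/hasP; exists C => //.
move: CBA; rewrite !mem_filter !inE => /andP[-> ].
rewrite (meetC B A) (meetC B (~` A)%O) (meetC (~` B)%O A).
by rewrite (meetC (~` B)%O (~` A)%O) /=; case/or4P => ->; rewrite ?orbT.
Qed.

End Constituents.

Section Coherence.
Context {d : Order.disp_t} {T : ctbDistrLatticeType d} {R : realType}.
Variables (A B : T) (x y mu p : R).
Hypothesis coh : coherent A B x y mu p.

(** No coherent bet has a uniformly positive gain. The [has] hypothesis keeps the list of values
    nonempty; otherwise [seq_min] would be its default 0, which says nothing about [c]. *)
Lemma coherent_gain_le0 (S : {set 'I_4}) (s : 'I_4 -> R) (c : R) : S != set0 ->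
  has (fun C => C <= \join_(i in S) tnth (conditioning A B) i)%O
      (constituents A B) ->
  (forall C, C \in constituents A B ->
     (C <= \join_(i in S) tnth (conditioning A B) i)%O ->
     c <= \sum_(i in S) s i * tnth (gains A B x y mu p) i C) ->
  c <= 0.
Proof.
move=> S0 hasC lec; have /andP[+ _] := coh s S0; apply: le_trans.
apply: le_seq_min.
  by rewrite /bet_values -size_eq0 size_map size_eq0 -has_filter.
move=> v /mapP[C]; rewrite mem_filter => /andP[CS CAB] ->.
exact: lec.
Qed.

Lemma coherent_x_ge0 : B != \bot%O -> 0 <= x.
Proof.
move=> B0; rewrite -oppr_le0.
have S0 : [set @Ordinal 4 0 isT] != set0 by rewrite -card_gt0 cards1.
(* With stake 1 the gain on [B] is [1 - x] or [- x], so [- x] is a lower bound. *)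
apply: (@coherent_gain_le0 _ (fun=> 1) _ S0); rewrite big_set1.
  exact: has_constituent_le_r.
move=> C CAB /=; rewrite !(tnth_nth B) /= => CB.
rewrite big_set1 (tnth_nth (fun=> 0)) /= /indic CB.
by case: (C <= A)%O; rewrite /= ?(mulr1n, mulr0n); lra.
Qed.

Lemma coherent_y_ge0 : A != \bot%O -> 0 <= y.
Proof.
move=> A0; rewrite -oppr_le0.
have S0 : [set @Ordinal 4 1 isT] != set0 by rewrite -card_gt0 cards1.
apply: (@coherent_gain_le0 _ (fun=> 1) _ S0); rewrite big_set1.
  exact: has_constituent_le_l.
move=> C CAB /=; rewrite !(tnth_nth B) /= => CA.
rewrite big_set1 (tnth_nth (fun=> 0)) /= /indic CA.
by case: (C <= B)%O; rewrite /= ?(mulr1n, mulr0n); lra.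
Qed.

(** Both sides carry the same [mu] off the join, so the content lies in the constituents where
    exactly one event holds. *)
Lemma conjunction_cond_event C : 0 <= x -> 0 <= y -> C \in constituents A B ->
  conjunction A B x y mu C = cond_event (A `&` B)%O (A `|` B)%O mu C.
Proof.
move=> x0 y0 CAB; have [CA CB] := constituent_le_compl CAB.
rewrite /conjunction /cond_event /cond_quantity /indic complU !lexI CA CB.
rewrite (constituent_le_join CAB).
case: (C <= A)%O; case: (C <= B)%O;
  rewrite /= ?(mulr0, mulr1, mul0r, addr0, add0r) ?minxx //.
(* If [A] holds without [B], the minimum is that of [x] and 0; in the symmetric case, of 0 and
   [y]. *)
- by rewrite min_r.
- by rewrite min_l.
Qed.

Lemma coherent_conjunction_eq : A != \bot%O -> B != \bot%O -> mu = p.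
Proof.
move=> A0 B0.
pose i2 := @Ordinal 4 2 isT; pose i3 := @Ordinal 4 3 isT.
have S0 : [set i2; i3] != set0 by rewrite -card_gt0 cards2.
have i23 : i2 \notin [set i3] by rewrite inE.
have joinE : (\join_(i in [set i2; i3]) tnth (conditioning A B) i = A `|` B)%O.
  by rewrite big_setU1 //= big_set1 !(tnth_nth B) /= joinxx.
have hasC : has (fun C => C <= A `|` B)%O (constituents A B).
  apply: sub_has (@has_constituent_le_l _ _ A B A0) => C CA.
  exact: le_trans CA (leUl _ _).
(* Opposite stakes [t] and [- t] cancel the indicator of the meet and leave a constant gain. The
   free sign of [t] yields both inequalities between [mu] and [p]. *)
have bet (t : R) : t * (p - mu) <= 0.
  apply: (@coherent_gain_le0 _ (fun i => if i == i2 then t else - t) _ S0).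
    by rewrite joinE.
  rewrite joinE => C CAB CAoB.
  rewrite big_setU1 //= big_set1 !(tnth_nth (fun=> 0)) /=.
  rewrite conjunction_cond_event ?coherent_x_ge0 ?coherent_y_ge0 //.
  have [CA CB] := constituent_le_compl CAB; move: CAoB.
  rewrite /cond_event /cond_quantity /indic complU !lexI CA CB.
  rewrite (constituent_le_join CAB).
  by case: (C <= A)%O; case: (C <= B)%O => //= _; rewrite ?(mulr1n, mulr0n, minxx); lra.
by have := bet 1; have := bet (- 1); lra.
Qed.

End Coherence.

Unset Implicit Arguments.

Theorem theorem7 (d : Order.disp_t) (T : ctbDistrLatticeType d) (R : realType)
    (A B : T) (hA : A != \bot%O) (hB : B != \bot%O)
    (x y mu p : R) (hcoh : coherent A B x y mu p) :
  (forall C : T, C \in constituents A B ->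
     conjunction A B x y mu C = cond_event (A `&` B)%O (A `|` B)%O p C) /\
  ((~` A `&` ~` B)%O != \bot%O -> mu = p).
Proof.
have mup := coherent_conjunction_eq hcoh hA hB.
split=> // C CAB; rewrite -mup.
exact: conjunction_cond_event (coherent_x_ge0 hcoh hB)
  (coherent_y_ge0 hcoh hA) CAB.
Qed.
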